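(* Let $(X,\alpha)$ be a Cantor minimal system and let $\phi:X\to\operatorname{Homeo}(\mathbb{T})$ be a continuous map such that $\alpha\times\phi$ is not orientation preserving. Let $A=C^*(X\times\mathbb{T},\alpha\times\phi)$ with implementing unitary $u$, and let $\theta\in\operatorname{Aut}(A)$ be the automorphism of order two defined by $\theta(f)=f$ for all $f\in C(X\times\mathbb{T})$ and $\theta(u)=ug$, where $g\in C(X\times\mathbb{T})$ is given by $g(x,t)=(-1)^{o(\phi)(x)}$. Then the crossed product $C^*$-algebra arising from the dynamical system $(X\times\mathbb{Z}_2\times\mathbb{T},\alpha\times o(\phi)\times\phi\pi)$ is isomorphic to $A\rtimes_\theta\mathbb{Z}_2$.
   Context: $\mathbb{T}=\mathbb{R}/\mathbb{Z}$, $\mathbb{Z}_2=\mathbb{Z}/2\mathbb{Z}$. A Cantor minimal system is a pair $(X,\alpha)$ with $X$ the Cantor set and $\alpha$ a minimal homeomorphism. $\alpha\times\phi$ is the homeomorphism $(x,t)\mapsto(\alpha(x),\phi_x(t))$ of $X\times\mathbb{T}$. $o(\phi):X\to\mathbb{Z}_2$ is the continuous function with $o(\phi)(x)=0$ if $\phi_x$ is orientation preserving and $o(\phi)(x)=1$ if $\phi_x$ is orientation reversing. $\alpha\times\phi$ is called orientation preserving if the class of $o(\phi)$ is zero in $C(X,\mathbb{Z}_2)/\{f-f\circ\alpha^{-1}:f\in C(X,\mathbb{Z}_2)\}$ (which is identified with $K^0(X,\alpha)/2K^0(X,\alpha)$, where $K^0(X,\alpha)=C(X,\mathbb{Z})/\{f-f\circ\alpha^{-1}\}$).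 $\pi:X\times\mathbb{Z}_2\to X$ is the projection onto the first coordinate, and $\alpha\times o(\phi)\times\phi\pi$ is the homeomorphism $(x,k,t)\mapsto(\alpha(x),k+o(\phi)(x),\phi_x(t))$ of $X\times\mathbb{Z}_2\times\mathbb{T}$. $C^*(Z,\gamma)$ denotes the crossed product of $C(Z)$ by $\mathbb{Z}$, with implementing unitary $u$ satisfying $ufu^*=f\circ\gamma^{-1}$. *)

(* Defs.v *)
From HB Require Import structures.
From mathcomp Require Import all_boot all_order all_algebra.
From mathcomp Require Import generic_quotient complex ring lra.
From mathcomp Require Import all_classical all_reals all_analysis.
Import Order.TTheory GRing.Theory Num.Theory.
Import numFieldNormedType.Exports.

Set Implicit Arguments.
Unset Strict Implicit.
Unset Printing Implicit Defensive.

Local Open Scope classical_set_scope.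
Local Open Scope complex_scope.
Local Open Scope ring_scope.

HB.mixin Record Algebra_hasStar (R : realType) A of GRing.Algebra R[i] A := {
  star : A -> A ;
  starK : involutive star ;
  starD : {morph star : x y / x + y} ;
  starZ : forall (a : R[i]) x, star (a *: x) = a^*%C *: star x ;
  starM : forall x y, star (x * y) = star y * star x
}.

#[short(type="starAlgType")]
HB.structure Definition StarAlgebra (R : realType) :=
  {A of GRing.Algebra R[i] A & Algebra_hasStar R A}.

(* The norm is a field of its own: Hierarchy Builder rejects a structure that is
   both a ring and a [normedModType], since the library declares no such join
   below [numDomainType]. Nontriviality (1 <> 0) comes with [algType]. *)
HB.mixin Record StarAlgebra_isCStar (R : realType) A of StarAlgebra R A := {
  cnorm : A -> R ;
  cnorm0_eq0 : forall x, cnorm x = 0 -> x = 0 ;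
  ler_cnormD : forall x y, cnorm (x + y) <= cnorm x + cnorm y ;
  cnormZ : forall (a : R[i]) x, cnorm (a *: x) = complex.Re `|a| * cnorm x ;
  ler_cnormM : forall x y, cnorm (x * y) <= cnorm x * cnorm y ;
  cnorm_starM : forall x, cnorm (star x * x) = cnorm x ^+ 2 ;
  cnorm_complete : forall u : nat -> A,
    (forall e : R, 0 < e -> exists N, forall m n,
       (N <= m)%N -> (N <= n)%N -> cnorm (u m - u n) < e) ->
    exists l, forall e : R, 0 < e -> exists N, forall n,
       (N <= n)%N -> cnorm (u n - l) < e
}.

#[short(type="cstarAlgType")]
HB.structure Definition CStarAlgebra (R : realType) :=
  {A of StarAlgebra R A & StarAlgebra_isCStar R A}.

Definition star_hom (R : realType) (A B : starAlgType R) (f : A -> B) : Prop :=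
  [/\ linear f, monoid_morphism f & {morph f : x / star x}].

Definition star_iso (R : realType) (A B : starAlgType R) (f : A -> B) : Prop :=
  star_hom f /\ bijective f.

Definition star_isomorphic (R : realType) (A B : starAlgType R) : Prop :=
  exists f : A -> B, star_iso f.

Definition unitary (R : realType) (A : starAlgType R) (u : A) : Prop :=
  star u * u = 1 /\ u * star u = 1.

(* The *-algebra C(Z) of continuous functions from Z to the complex numbers; Z is
   pointed below only to make C(Z) nontrivial. *)
Definition cfun (R : realType) (Z : topologicalType) : Type :=
  continuousType Z R[i]^o.

Section CFun.
Context (R : realType) (Z : ptopologicalType).
Local Notation C := (R[i]^o).
Local Notation CZ := (cfun R Z).

HB.instance Definition _ := Choice.on CZ.

Lemma cfunP (f g : CZ) : (forall z, f z = g z) -> f = g.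
Proof. by move=> fg; apply/continuousEP. Qed.

Lemma conjc_continuous : continuous (fun a : C => a^*%C : C).
Proof.
move=> a U /nbhs_ballP[e e0 eU]; apply/nbhs_ballP; exists e => //= b ab.
by apply: eU; move: ab; rewrite /ball /= -rmorphB normcJ.
Qed.

Definition cfun_add (f g : CZ) : CZ :=
  mkcts (fun z => cvgD (@cts_fun _ _ f z) (@cts_fun _ _ g z)).
Definition cfun_opp (f : CZ) : CZ := mkcts (fun z => cvgN (@cts_fun _ _ f z)).
Definition cfun_mul (f g : CZ) : CZ :=
  mkcts (fun z => cvgM (@cts_fun _ _ f z) (@cts_fun _ _ g z)).
Definition cfun_const (a : C) : CZ := cst a.
Definition cfun_star (f : CZ) : CZ :=
  mkcts (fun z => continuous_comp (@cts_fun _ _ f z) (@conjc_continuous (f z))).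


Let cfun_addA : associative cfun_add.
Proof. by move=> f g h; apply: cfunP => z; exact: addrA. Qed.
Let cfun_addC : commutative cfun_add.
Proof. by move=> f g; apply: cfunP => z; exact: addrC. Qed.
Let cfun_add0 : left_id (cfun_const 0) cfun_add.
Proof. by move=> f; apply: cfunP => z; exact: add0r. Qed.
Let cfun_addN : left_inverse (cfun_const 0) cfun_opp cfun_add.
Proof. by move=> f; apply: cfunP => z; exact: addNr. Qed.

HB.instance Definition _ := GRing.isZmodule.Build CZ
  cfun_addA cfun_addC cfun_add0 cfun_addN.

Let cfun_mulA : associative cfun_mul.
Proof. by move=> f g h; apply: cfunP => z; exact: mulrA. Qed.
Let cfun_mulC : commutative cfun_mul.
Proof. by move=> f g; apply: cfunP => z; exact: mulrC. Qed.
Let cfun_mul1 : left_id (cfun_const 1) cfun_mul.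
Proof. by move=> f; apply: cfunP => z; exact: mul1r. Qed.
Let cfun_mulDl : left_distributive cfun_mul cfun_add.
Proof. by move=> f g h; apply: cfunP => z; exact: mulrDl. Qed.
Let cfun_oneN0 : cfun_const 1 != cfun_const 0.
Proof.
apply/eqP => /(congr1 (fun f : CZ => f point)) /eqP.
by rewrite /= oner_eq0.
Qed.

HB.instance Definition _ := GRing.Zmodule_isComNzRing.Build CZ
  cfun_mulA cfun_mulC cfun_mul1 cfun_mulDl cfun_oneN0.

Definition cfun_scale (a : R[i]) (f : CZ) : CZ := cfun_mul (cfun_const a) f.

Let cfun_scaleA a b f : cfun_scale a (cfun_scale b f) = cfun_scale (a * b) f.
Proof. by apply: cfunP => z; exact: mulrA. Qed.
Let cfun_scale1 : left_id 1 cfun_scale.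
Proof. by move=> f; apply: cfunP => z; exact: mul1r. Qed.
Let cfun_scaleDr : right_distributive cfun_scale +%R.
Proof. by move=> a f g; apply: cfunP => z; exact: mulrDr. Qed.
Let cfun_scaleDl f : {morph cfun_scale^~ f : a b / a + b}.
Proof. by move=> a b; apply: cfunP => z; exact: mulrDl. Qed.

HB.instance Definition _ := GRing.Zmodule_isLmodule.Build R[i] CZ
  cfun_scaleA cfun_scale1 cfun_scaleDr cfun_scaleDl.

Let cfun_scaleAl (a : R[i]) (f g : CZ) : a *: (f * g) = (a *: f) * g.
Proof. by apply: cfunP => z; exact: mulrA. Qed.

HB.instance Definition _ := GRing.Lmodule_isLalgebra.Build R[i] CZ cfun_scaleAl.
HB.instance Definition _ := GRing.Lalgebra_isComAlgebra.Build R[i] CZ.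

Let cfun_starK : involutive cfun_star.
Proof. by move=> f; apply: cfunP => z; exact: conjcK. Qed.
Let cfun_starD : {morph cfun_star : f g / f + g}.
Proof. by move=> f g; apply: cfunP => z; exact: rmorphD. Qed.
Let cfun_starZ (a : R[i]) f : cfun_star (a *: f) = a^*%C *: cfun_star f.
Proof. by apply: cfunP => z; exact: rmorphM. Qed.
Let cfun_starM f g : cfun_star (f * g) = cfun_star g * cfun_star f.
Proof. by apply: cfunP => z; rewrite [RHS]mulrC; exact: rmorphM. Qed.

HB.instance Definition _ := Algebra_hasStar.Build R CZ
  cfun_starK cfun_starD cfun_starZ cfun_starM.

End CFun.

Record homeo (X Y : topologicalType) := Homeo {
  homeo_fun :> X -> Y ;
  homeo_inv : Y -> X ;
  homeo_cts : continuous homeo_fun ;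
  homeo_inv_cts : continuous homeo_inv ;
  homeoK : cancel homeo_fun homeo_inv ;
  homeo_invK : cancel homeo_inv homeo_fun
}.

Definition homeo_sym (X Y : topologicalType) (h : homeo X Y) : homeo Y X :=
  Homeo (@homeo_inv_cts X Y h) (@homeo_cts X Y h) (@homeo_invK X Y h) (@homeoK X Y h).

(* For compact Hausdorff X and Y, the compact-open topology on the homeomorphisms
   is that of uniform convergence, and makes Homeo(X) a topological group. *)
HB.instance Definition _ (X Y : topologicalType) := gen_eqMixin (homeo X Y).
HB.instance Definition _ (X Y : topologicalType) := gen_choiceMixin (homeo X Y).
HB.instance Definition _ (X Y : topologicalType) :=
  Topological.copy (homeo X Y)
    (initial_topology (fun h : homeo X Y => (h : X -> Y) : {compact-open, X -> Y})).

Definition minimal_homeo (X : topologicalType) (alpha : homeo X X) : Prop :=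
  forall E : set X, closed E -> alpha @` E = E -> E = set0 \/ E = setT.

Definition is_cantor_set (X : topologicalType) : Prop :=
  inhabited (homeo X cantor_space).

(* The crossed product of A by the discrete group G, as the universal C*-algebra
   of covariant pairs; it is unique up to a unique isomorphism compatible with
   [rho] and [U]. Only the *-algebra structure of A is needed, since
   *-homomorphisms from a C*-algebra to a C*-algebra are contractive. *)
Section CrossedProduct.
Context (R : realType) (A : starAlgType R) (G : zmodType) (beta : G -> A -> A).

Record covariant_pair (B : starAlgType R) (rho : A -> B) (U : G -> B) : Prop := {
  covariant_hom : star_hom rho ;
  covariant_unitary : forall g, unitary (U g) ;
  covariantD : {morph U : g h / g + h >-> g * h} ;
  covariantE : forall g a, U g * rho a * star (U g) = rho (beta g a)
}.

Record is_crossed_product (B : cstarAlgType R) (rho : A -> B) (U : G -> B) :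
  Prop := {
  crossed_product_covariant : covariant_pair rho U ;
  crossed_product_universal : forall (D : cstarAlgType R) (rho' : A -> D) U',
    covariant_pair rho' U' ->
    exists! Phi : B -> D,
      [/\ star_hom Phi, Phi \o rho = rho' & Phi \o U = U']
}.

End CrossedProduct.

Section HomeoAction.
Context (R : realType) (Z : ptopologicalType).

Definition cfun_comp (f : cfun R Z) (h : homeo Z Z) : cfun R Z :=
  mkcts (fun z => continuous_comp (@homeo_cts _ _ h z) (@cts_fun _ _ f (h z))).

(* The integer n acts by f |-> f o gamma^{-n}. If [U] implements this action then
   U 1 is the unitary u such that u f u^* = f o gamma^{-1}. *)
Definition homeo_action (gamma : homeo Z Z) (n : int) : cfun R Z -> cfun R Z :=
  match n with
  | Posz k => iter k (cfun_comp^~ (homeo_sym gamma))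
  | Negz k => iter k.+1 (cfun_comp^~ gamma)
  end.

Definition is_transformation_algebra (gamma : homeo Z Z)
    (A : cstarAlgType R) (iota : cfun R Z -> A) (U : int -> A) : Prop :=
  is_crossed_product (homeo_action gamma) iota U.

End HomeoAction.

Definition Z2 : Type := 'Z_2.
HB.instance Definition _ := GRing.Zmodule.copy Z2 'Z_2.
HB.instance Definition _ := isPointed.Build Z2 (0 : 'Z_2).
HB.instance Definition _ := hasNbhs.Build Z2 principal_filter.
HB.instance Definition _ := Discrete_ofNbhs.Build Z2 erefl.

Definition Z2_action (A : Type) (theta : A -> A) (k : Z2) : A -> A :=
  iter (nat_of_ord k) theta.

Definition order_two (A : Type) (theta : A -> A) : Prop :=
  involutive theta /\ exists a, theta a <> a.

Section Circle.
Local Open Scope quotient_scope.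
Context (R : realType).

Definition int_congr (x y : R) : bool := (x - y) \is a Num.int.

Lemma int_congr_equiv : equiv_class_of int_congr.
Proof.
split=> [x|x y|y x z]; rewrite /int_congr ?subrr//.
- by rewrite -opprB rpredN.
- by move=> xy yz; rewrite -(subrKA y) rpredD.
Qed.

Canonical int_congr_equiv_rel := EquivRelPack int_congr_equiv.

Definition circle : Type := quotient_topology {eq_quot int_congr_equiv_rel}.
HB.instance Definition _ := PointedTopological.copy circle
  (quotient_topology {eq_quot int_congr_equiv_rel}).

Definition to_circle (x : R) : circle := \pi_{eq_quot int_congr_equiv_rel} x.

Lemma to_circle_eq x y : (to_circle x = to_circle y) <-> (x - y) \is a Num.int.
Proof.
split=> [/eqmodP//|xy]. by apply/eqmodP.
Qed.

Lemma to_circle_surj t : exists x, t = to_circle x.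
Proof. by exists (repr t); rewrite /to_circle reprK. Qed.

Lemma to_circle_cts : continuous to_circle.
Proof. exact: pi_continuous. Qed.

End Circle.

HB.instance Definition _ (X Y : ptopologicalType) := Pointed.on (X * Y)%type.

Section CircleTopology.
Context (R : realType).
Local Notation T := (circle R).
Local Notation pi := (@to_circle R).

Lemma to_circle_open (U : set R) : open U -> open (pi @` U).
Proof.
move=> oU; change (open (pi @^-1` (pi @` U))).
rewrite openE => x [u Uu /to_circle_eq uxZ].
have /nbhs_ballP[e /= e0 eU] : nbhs u U by apply: open_nbhs_nbhs.
apply/nbhs_ballP; exists e => //= y xy; exists (y + (u - x)).
  apply: eU; rewrite /ball /= -[_ - _]/(u - (y + (u - x))).
  by have -> : u - (y + (u - x)) = x - y by ring.
by apply/to_circle_eq; rewrite addrAC subrr add0r.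
Qed.

Lemma nbhs_to_circle (x e : R) : 0 < e -> nbhs (pi x) (pi @` ball x e).
Proof.
move=> e0; apply: open_nbhs_nbhs; split.
  by apply: to_circle_open; exact: ball_open.
by exists x => //; exact: ballxx.
Qed.

Lemma circle_compact : compact [set: T].
Proof.
have -> : [set: T] = pi @` `[0, 1].
  apply/seteqP; split=> // t _; have [x ->] := to_circle_surj t.
  exists (x - (Num.floor x)%:~R).
    have := floorD1_gt x; have := floor_le x.
    by rewrite intrD /= in_itv /=; lra.
  apply/to_circle_eq; rewrite addrAC subrr add0r rpredN; exact: intr_int.
apply: continuous_compact; last exact: segment_compact.
by apply: continuous_subspaceT; exact: to_circle_cts.
Qed.

Lemma circle_separated (s t : T) : s <> t ->
  exists U V, [/\ nbhs s U, nbhs t V & forall z, U z -> V z -> False].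
Proof.
have [x ->] := to_circle_surj s; have [y ->] := to_circle_surj t => xy.
pose n := Num.floor (x - y).
have n1 : n%:~R < x - y.
  rewrite lt_neqAle floor_le andbT; apply/eqP => nE; apply: xy.
  by apply/to_circle_eq; rewrite -nE intr_int.
have n2 : x - y < n%:~R + 1 by have := floorD1_gt (x - y); rewrite intrD.
pose d := Num.min (x - y - n%:~R) (n%:~R + 1 - (x - y)) / 2.
have d0 : 0 < d by rewrite divr_gt0// lt_min !subr_gt0 n1.
exists (pi @` ball x d), (pi @` ball y d); split; try exact: nbhs_to_circle.
move=> _ [a xa <-] [b yb /to_circle_eq /intrP[m bam]].
move: xa yb; rewrite /ball /= !ltr_norml => /andP[xa1 xa2] /andP[yb1 yb2].
have dl : d *+ 2 <= x - y - n%:~R by rewrite -mulr_natr divfK// ge_min lexx.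
have dr : d *+ 2 <= n%:~R + 1 - (x - y).
  by rewrite -mulr_natr divfK// ge_min lexx orbT.
have [nm|mn] := leP (- m) n.
  have : ((- m)%:~R : R) <= n%:~R by rewrite ler_int.
  rewrite rmorphN /= -bam; lra.
have : (n + 1)%:~R <= ((- m)%:~R : R) by rewrite ler_int lezD1.
rewrite rmorphN intrD /= -bam; lra.
Qed.

End CircleTopology.

Lemma pair_cts (S X Y : topologicalType) (f : S -> X) (g : S -> Y) :
  continuous f -> continuous g -> continuous (fun s => (f s, g s)).
Proof. by move=> cf cg s; apply: (cvg_pair (cf s) (cg s)). Qed.

Section SkewProduct.
Context (R : realType) (X : topologicalType) (alpha : homeo X X).
Local Notation T := (circle R).
Local Notation pi := (@to_circle R).
Variable phi : continuousType X (homeo T T).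

Lemma skew_near (x0 : X) (t0 : T) (O : set T) : open O -> O (phi x0 t0) ->
  exists A B, [/\ nbhs x0 A, nbhs t0 B & forall x t, A x -> B t -> O (phi x t)].
Proof.
move=> oO; have [r ->] := to_circle_surj t0 => Or.
have : nbhs r ((phi x0 \o pi) @^-1` O).
  apply: (continuous_comp (@to_circle_cts R r) (@homeo_cts _ _ (phi x0) _)).
  exact: open_nbhs_nbhs.
move=> /nbhs_ballP[e /= e0 eO].
pose K := pi @` `[r - e / 2, r + e / 2].
have cK : compact K.
  apply: continuous_compact; last exact: segment_compact.
  by apply: continuous_subspaceT; exact: to_circle_cts.
pose W : set (homeo T T) := [set h | h @` K `<=` O].
have oW : open W.
  have /continuousP := @initial_continuous (homeo T T) {compact-open, T -> T}
    (fun h => (h : T -> T)).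
  by apply; exact: compact_open_open.
exists (phi @^-1` W), K; split.
- apply: (@cts_fun _ _ phi); apply: open_nbhs_nbhs; split=> //.
  move=> _ [_ [s /= +] <-] <-; rewrite in_itv /= => /andP[s1 s2].
  by apply: eO; rewrite /ball /= ltr_norml; apply/andP; split; lra.
- have e2 : 0 < e / 2 by rewrite divr_gt0.
  apply: (filterS _ (nbhs_to_circle r e2)); apply: image_subset => s.
  rewrite /ball /= ltr_norml in_itv /= => /andP[s1 s2].
  by apply/andP; split; lra.
- by move=> x t + Kt; apply; exists t.
Qed.

Lemma skew_cts : continuous (fun p : X * T => phi p.1 p.2).
Proof.
move=> [x0 t0] O; rewrite nbhsE => -[ V' [oV' V't] V'O].
have [A [B [nA nB AB]]] := skew_near oV' V't.
by exists (A, B) => //= -[x t] /= [Ax Bt]; apply/V'O/AB.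
Qed.

Lemma skew_inv_cts : continuous (fun p : X * T => homeo_inv (phi p.1) p.2).
Proof.
move=> [x0 t0] O /=; rewrite nbhsE => -[ V' [oV' V't] V'O].
have cO : compact (~` V').
  apply: (subclosed_compact _ (@circle_compact R)) => //.
  exact: open_closedC.
have /compact_near_coveringP cov := cO.
have H : \forall p \near (x0, t0), forall s, (~` V') s -> phi p.1 s <> p.2.
  apply: (cov _ (nbhs (x0, t0)) (fun p s => phi p.1 s <> p.2) _) => s V's.
  have st : phi x0 s <> t0.
    by move=> st; apply: V's; rewrite -(homeoK (phi x0) s) st.
  have [U [V [nU nV UV]]] := circle_separated st.
  move: nU; rewrite nbhsE => -[U' [oU' U's] U'U].
  have [A [B [nA nB AB]]] := skew_near oU' U's.
  exists (B, (A `*` V)); first by split=> //=; exists (A, V).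
  move=> [s' [x t]] /= [Bs' [Ax Vt]] E; apply: (UV t) => //.
  by rewrite -E; apply/U'U/AB.
apply: (filterS _ H) => -[x t] /= {}H.
apply: V'O; apply: contrapT => /H; rewrite homeo_invK; exact.
Qed.

Definition skew_fun (p : X * T) : X * T := (alpha p.1, phi p.1 p.2).
Definition skew_inv (p : X * T) : X * T :=
  (homeo_inv alpha p.1, homeo_inv (phi (homeo_inv alpha p.1)) p.2).

Lemma skew_fun_cts : continuous skew_fun.
Proof.
apply: pair_cts; last exact: skew_cts.
by move=> p; apply: continuous_comp; [exact: cvg_fst|exact: homeo_cts].
Qed.

Lemma skew_inv_fun_cts : continuous skew_inv.
Proof.
have a : continuous (fun q : X * T => homeo_inv alpha q.1).
  by move=> p; apply: continuous_comp; [exact: cvg_fst|exact: homeo_inv_cts].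
apply: pair_cts; first exact: a.
move=> p; apply: (@continuous_comp _ _ _
  (fun q : X * T => (homeo_inv alpha q.1, q.2))
  (fun q : X * T => homeo_inv (phi q.1) q.2)); last exact: skew_inv_cts.
by move: p; apply: pair_cts; [exact: a|move=> p; exact: cvg_snd].
Qed.

Lemma skew_funK : cancel skew_fun skew_inv.
Proof. by case=> x t; rewrite /skew_inv /= !homeoK. Qed.

Lemma skew_invK : cancel skew_inv skew_fun.
Proof. by case=> x t; rewrite /skew_fun /= !homeo_invK. Qed.

Definition skew_product : homeo (X * T)%type (X * T)%type :=
  Homeo skew_fun_cts skew_inv_fun_cts skew_funK skew_invK.

End SkewProduct.

Section Orientation.
Context (R : realType).
Local Notation T := (circle R).
Local Notation pi := (@to_circle R).

(* The lifts of h to the real line are increasing. *)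
Definition orientation_preserving (h : homeo T T) : Prop :=
  exists F : R -> R, [/\ continuous F, {homo F : x y / x < y} &
    forall x, pi (F x) = h (pi x)].

(* A homeomorphism of the circle that does not preserve the orientation
   reverses it. *)
Definition orientation (h : homeo T T) : Z2 :=
  if `[< orientation_preserving h >] then (0 : 'Z_2) else (1 : 'Z_2).

Let near_points (s t : T) : Prop :=
  exists a b, [/\ s = pi a, t = pi b & `|a - b| < 4^-1].

Let small_int_eq0 (x : R) : x \is a Num.int -> `|x| < 1 -> x = 0.
Proof.
move=> xZ x1; apply/eqP; apply: contraTT x1 => x0.
by rewrite -leNgt norm_intr_ge1.
Qed.

Let orientation_preserving_near (h h' : homeo T T) :
  (forall t, near_points (h t) (h' t)) ->
  orientation_preserving h -> orientation_preserving h'.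
Proof.
move=> hh' [F [cF mF piF]].
have /choice[G GP] : forall r, exists s, pi s = h' (pi r) /\ `|F r - s| < 4^-1.
  move=> r; have [a [b [ha hb ab]]] := hh' (pi r).
  move: ha; rewrite -piF => /to_circle_eq Fa.
  exists (b + (F r - a)); split; last by congr (`|_| < _): ab; ring.
  by rewrite hb; apply/to_circle_eq; rewrite addrAC subrr add0r.
have Guniq r s : pi s = h' (pi r) -> `|F r - s| < 4^-1 -> s = G r.
  move=> hs Fs; have [hG FG] := GP r; apply/eqP; rewrite -subr_eq0; apply/eqP.
  apply: small_int_eq0; first by apply/to_circle_eq; rewrite hs hG.
  by move: Fs FG; rewrite !ltr_norml => /andP[? ?] /andP[? ?]; apply/andP; lra.
have cG : continuous G.
  move=> r; apply/cvgrPdist_lt => e e0.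
  have [hG FG] := GP r.
  pose d := Num.min (e * 2) (4^-1 - `|F r - G r|) / 2.
  have d0 : 0 < d by rewrite divr_gt0// lt_min mulr_gt0//= subr_gt0.
  have de : d <= e by rewrite ler_pdivrMr// ge_min lexx.
  have dF : d *+ 2 <= 4^-1 - `|F r - G r|.
    by rewrite -mulr_natr divfK// ge_min lexx orbT.
  have n1 : \forall x \near r, (pi @` ball (G r) d) (h' (pi x)).
    apply: (continuous_comp (@to_circle_cts R r) (@homeo_cts _ _ h' _)).
    have : nbhs (pi (G r)) (pi @` ball (G r) d) by exact: nbhs_to_circle.
    by rewrite hG.
  have n2 : \forall x \near r, `|F r - F x| < d.
    by have /cvgrPdist_lt := cF r; exact.
  apply: filterS2 n1 n2 => x [s Gs hs] Fx.
  have Gsd : `|G r - s| < d := Gs.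
  rewrite -(Guniq x s hs); first exact: lt_le_trans de.
  have := ler_norm (F r - G r); have := ler_norm (- (F r - G r)).
  rewrite normrN => *.
  by move: Gsd Fx; rewrite !ltr_norml => /andP[? ?] /andP[? ?]; apply/andP; lra.
have iG : injective G.
  move=> x y Gxy; have [hx Fx] := GP x; have [hy Fy] := GP y.
  have hxy : pi x = pi y by apply: (can_inj (homeoK h')); rewrite -hx -hy Gxy.
  have Fxy : F x - F y = 0.
    apply: small_int_eq0; first by apply/to_circle_eq; rewrite !piF hxy.
    move: Fx Fy; rewrite -Gxy !ltr_norml => /andP[? ?] /andP[? ?].
    by apply/andP; lra.
  by case: (ltgtP x y) => // /mF; lra.
have G01 : G 0 <= G 1.
  have F01 : 1 <= F 1 - F 0.
    rewrite -[leRHS]gtr0_norm ?subr_gt0 ?mF//; apply: norm_intr_ge1.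
      apply/to_circle_eq; rewrite !piF; congr (h _); apply/to_circle_eq.
      by rewrite subr0.
    by rewrite subr_eq0 gt_eqF// mF.
  have [_] := GP 0; have [_] := GP 1.
  by rewrite !ltr_norml => /andP[? ?] /andP[? ?]; lra.
exists G; split=> // [|r]; last by have [] := GP r.
have mG : {in `]-oo, +oo[ &, {mono G : x y / x <= y}}.
  apply: itv_continuous_inj_le; first by exists 0, 1; rewrite !in_itv.
    by apply: continuous_subspaceT.
  by move=> x y _ _; exact: iG.
by move=> x y xy; rewrite !ltNge mG ?in_itv// -ltNge.
Qed.

Let near_points_sym s t : near_points s t -> near_points t s.
Proof. by move=> [a [b [-> -> ab]]]; exists b, a; rewrite distrC. Qed.

Lemma orientation_locally_constant (X : topologicalType)
    (phi : continuousType X (homeo T T)) (x0 : X) :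
  \forall x \near x0, orientation (phi x) = orientation (phi x0).
Proof.
have /compact_near_coveringP cov := @circle_compact R.
have : \forall x \near x0, [set: T] `<=`
    (fun t => near_points (phi x0 t) (phi x t)).
  apply: (cov _ (nbhs x0) (fun x t => near_points (phi x0 t) (phi x t)) _).
  move=> t0 _; have [a pa] := to_circle_surj (phi x0 t0).
  pose U := pi @` ball a 8^-1.
  have oU : open U by apply: to_circle_open; exact: ball_open.
  have Ut : U (phi x0 t0) by exists a; [exact: ballxx|rewrite pa].
  have [A [B [nA nB AB]]] := skew_near oU Ut.
  exists (B, A) => // -[t x] /= [Bt Ax].
  have [b ab <-] := AB x0 t (nbhs_singleton nA) Bt.
  have [c ac <-] := AB x t Ax Bt.
  exists b, c; split=> //; move: ab ac; rewrite /ball /= !ltr_norml.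
  by move=> /andP[? ?] /andP[? ?]; apply/andP; lra.
apply: filterS => x xx0; rewrite /orientation; congr (if _ then _ else _).
apply/asbool_equiv_eq; split; apply: orientation_preserving_near => t.
  by apply: near_points_sym; exact: xx0.
exact: xx0.
Qed.

End Orientation.

Section OrientationCocycle.
Context (R : realType) (X : topologicalType).
Local Notation T := (circle R).
Variable phi : continuousType X (homeo T T).

Lemma orientation_cocycle_cts : continuous (fun x => orientation (phi x)).
Proof.
move=> x0 U U0; apply: filterS (orientation_locally_constant phi x0) => x /= ->.
exact: nbhs_singleton.
Qed.

Definition orientation_cocycle : continuousType X Z2 :=
  mkcts orientation_cocycle_cts.
End OrientationCocycle.

Section CocycleExtension.
Context (X : topologicalType) (alpha : homeo X X) (o : continuousType X Z2).

Definition cocycle_fun (p : X * Z2) : X * Z2 := (alpha p.1, p.2 + o p.1).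
Definition cocycle_inv (p : X * Z2) : X * Z2 :=
  (homeo_inv alpha p.1, p.2 - o (homeo_inv alpha p.1)).

Let Z2_cts2 (f g : X * Z2 -> Z2) (op : Z2 -> Z2 -> Z2) :
  continuous f -> continuous g -> continuous (fun p => op (f p) (g p)).
Proof.
move=> cf cg p U U0.
have nf : nbhs p (f @^-1` [set f p]) by apply: cf; exact: discrete_set1.
have ng : nbhs p (g @^-1` [set g p]) by apply: cg; exact: discrete_set1.
by apply: filterS2 nf ng => q /= -> ->; exact: nbhs_singleton.
Qed.

Lemma cocycle_fun_cts : continuous cocycle_fun.
Proof.
have a : continuous (fun q : X * Z2 => q.1) by move=> p; exact: cvg_fst.
apply: pair_cts => [p|].
  by apply: continuous_comp; [exact: a|exact: homeo_cts].
apply: (@Z2_cts2 _ _ +%R) => p; first exact: cvg_snd.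
by apply: (@continuous_comp _ _ _ _ o); [exact: a|exact: cts_fun].
Qed.

Lemma cocycle_inv_cts : continuous cocycle_inv.
Proof.
have a : continuous (fun q : X * Z2 => homeo_inv alpha q.1).
  by move=> p; apply: continuous_comp; [exact: cvg_fst|exact: homeo_inv_cts].
apply: pair_cts; first exact: a.
apply: (@Z2_cts2 _ _ (fun k l => k - l)) => p; first exact: cvg_snd.
by apply: (@continuous_comp _ _ _ (fun q : X * Z2 => homeo_inv alpha q.1) o); [exact: a|exact: cts_fun].
Qed.

Lemma cocycle_funK : cancel cocycle_fun cocycle_inv.
Proof. by case=> x k; rewrite /cocycle_inv /= homeoK addrK. Qed.

Lemma cocycle_invK : cancel cocycle_inv cocycle_fun.
Proof. by case=> x k; rewrite /cocycle_fun /= homeo_invK subrK. Qed.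

Definition cocycle_extension : homeo (X * Z2)%type (X * Z2)%type :=
  Homeo cocycle_fun_cts cocycle_inv_cts cocycle_funK cocycle_invK.

End CocycleExtension.

Section SignFunction.
Context (R : realType) (X : ptopologicalType).
Local Notation T := (circle R).
Variable phi : continuousType X (homeo T T).

Lemma orientation_sign_cts : continuous (fun p : X * T =>
  (-1) ^+ nat_of_ord (orientation_cocycle phi p.1) : R[i]^o).
Proof.
move=> p U U0; have n : \forall x \near p.1,
    orientation_cocycle phi x = orientation_cocycle phi p.1.
  exact: orientation_locally_constant.
have : nbhs p (fst @^-1` [set x | orientation_cocycle phi x =
                                  orientation_cocycle phi p.1]).
  exact: (@cvg_fst _ _ (nbhs p.1) (nbhs p.2)).
by apply: filterS => q /= ->; exact: nbhs_singleton.
Qed.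

Definition orientation_sign : cfun R (X * T)%type := mkcts orientation_sign_cts.

End SignFunction.

Definition skew_orientation_preserving (R : realType) (X : topologicalType) (alpha : homeo X X)
    (phi : continuousType X (homeo (circle R) (circle R))) : Prop :=
  exists f : continuousType X Z2,
    forall x, orientation_cocycle phi x = f x - f (homeo_inv alpha x).

Definition fst_cts (X Y : topologicalType) : continuousType (X * Y)%type X :=
  mkcts (fun p : X * Y => @cvg_fst X Y (nbhs p.1) (nbhs p.2) _).

Definition orientation_extension (R : realType) (X : topologicalType)
    (alpha : homeo X X) (phi : continuousType X (homeo (circle R) (circle R))) :
    homeo (X * Z2 * circle R)%type (X * Z2 * circle R)%type :=
  skew_product (cocycle_extension alpha (orientation_cocycle phi))
    (phi \o fst_cts X Z2).

(* Main.v *)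
Require Import Defs.
From HB Require Import structures.
From mathcomp Require Import all_boot all_order all_algebra.
From mathcomp Require Import generic_quotient complex.
From mathcomp Require Import all_classical all_reals all_analysis.
Import Order.TTheory GRing.Theory Num.Theory.
Import numFieldNormedType.Exports.

(** A function on X * Z2 * T is a pair of functions on X * T, one for each of the
two sheets; equivalently it is f0 + f1 * chi, with f0 and f1 pulled back from
X * T and chi(x,k,t) = (-1)^k. So C(X * Z2 * T) is C(X * T) with a selfadjoint
unitary chi adjoined ([sheet_hom_ex], [sheet_hom_eq]).

Write gamma for the homeomorphism of X * Z2 * T, and g for the sign of the
orientation cocycle, as in the theorem. Since gamma adds that cocycle to the
Z2-coordinate, the implementing unitary v of C^*(X * Z2 * T, gamma) satisfies
chi v chi = v g. This is the relation w u w = theta(u) = u g imposed on the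
generator w of Z2 in the crossed product of A by theta; and w, like chi, commutes
with C(X * T), since theta is trivial there. Hence both algebras are universal
for the same data: a covariant pair of the system on X * T with implementing
unitary u, and a selfadjoint unitary that commutes with C(X * T) and conjugates
u to u g. [cover_covariant_ex], [cover_covariant_lift] and
[cover_covariant_sign] translate between these data and covariant pairs of gamma.

The translations give homomorphisms D -> B and B -> D, by the existence half of
the universal properties. The uniqueness half shows that they are mutually
inverse, and also that conjugation by chi implements theta on all of A once it
does so on C(X * T) and on u ([crossed_product_hom_eq]). *)

Local Open Scope classical_set_scope.
Local Open Scope complex_scope.
Local Open Scope ring_scope.

(** * Unital *-homomorphisms *)

Section StarHomomorphisms.
Context {R : realType}.
Implicit Types A B C : starAlgType R.

Lemma star_homD {A B} {f : A -> B} : star_hom f -> {morph f : x y / x + y}.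
Proof. by case=> fL _ _ x y; have := fL 1 x y; rewrite !scale1r. Qed.

Lemma star_hom1 {A B} {f : A -> B} : star_hom f -> f 1 = 1.
Proof. by case=> _ []. Qed.

Lemma star_homM {A B} {f : A -> B} : star_hom f -> {morph f : x y / x * y}.
Proof. by case=> _ []. Qed.

Lemma star_hom_star {A B} {f : A -> B} : star_hom f -> {morph f : x / star x}.
Proof. by case. Qed.

Lemma star_hom0 {A B} {f : A -> B} : star_hom f -> f 0 = 0.
Proof.
by move=> fH; apply: (addrI (f 0)); rewrite -(star_homD fH) !addr0.
Qed.

Lemma star_homN {A B} {f : A -> B} : star_hom f -> {morph f : x / - x}.
Proof.
move=> fH x; apply: (addrI (f x)).
by rewrite -(star_homD fH) !subrr star_hom0.
Qed.

Lemma star_homX {A B} {f : A -> B} n :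
  star_hom f -> {morph f : x / x ^+ n}.
Proof.
move=> fH x; elim: n => [|n IHn]; first by rewrite !expr0 star_hom1.
by rewrite !exprS star_homM// IHn.
Qed.

Lemma star_hom_id {A} : star_hom (@id A).
Proof. by split. Qed.

Lemma star_hom_comp {A B C} {f : A -> B} {g : B -> C} :
  star_hom f -> star_hom g -> star_hom (g \o f).
Proof.
move=> fH [gL [g1 gM] gS]; case: (fH) => fL [f1 fM] fS.
split=> [a x y|//|x] /=; first by rewrite fL gL.
  by split=> [|x y] /=; rewrite ?f1 ?g1// fM gM.
by rewrite fS gS.
Qed.

Lemma star1 {A} : star (1 : A) = 1.
Proof. by rewrite -[LHS]mul1r -[X in X * _]starK -starM mul1r starK. Qed.

Lemma star_hom_unitary {A B} {f : A -> B} u :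
  star_hom f -> unitary u -> unitary (f u).
Proof.
by move=> fH [uu1 uu2]; split;
  rewrite -star_hom_star// -star_homM// ?uu1 ?uu2 star_hom1.
Qed.

Lemma star_hom_conj {A} {w : A} :
  unitary w -> star_hom (fun a => w * a * star w).
Proof.
move=> [w1 w2]; split=> [a x y||x].
- by rewrite mulrDr mulrDl -scalerAr -scalerAl.
- split=> [|x y]; first by rewrite mulr1.
  by rewrite !mulrA -[_ * star w * w]mulrA w1 mulr1.
- by rewrite !starM starK mulrA.
Qed.

(** Homomorphisms into two corners of B glue together: p and q are complementary
projections that commute with the ranges of f and g, so that f p and g q are
homomorphisms into pBp and qBq. *)
Lemma star_hom_orthogonal_sum {A B} {f g : A -> B} {p q : B} :
  star_hom f -> star_hom g -> star p = p -> star q = q ->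
  p + q = 1 -> p * q = 0 ->
  (forall a, p * f a = f a * p) -> (forall a, q * g a = g a * q) ->
  star_hom (fun a => f a * p + g a * q).
Proof.
move=> fH gH sp sq pq1 pq pf qg.
have pp : p * p = p by rewrite -[RHS]mulr1 -pq1 mulrDr pq addr0.
have qp : q * p = 0.
  by rewrite -[q](addKr p) pq1 mulrDl mulNr mul1r pp addNr.
have qq : q * q = q by rewrite -[RHS]mulr1 -pq1 mulrDr qp add0r.
split=> [a x y||x].
- case: fH gH => fL _ _ [gL _ _].
  by rewrite fL gL !mulrDl -!scalerAl scalerDr addrACA.
- split=> [|x y]; first by rewrite (star_hom1 fH) (star_hom1 gH) !mul1r.
  have fp a : f a * p * (f y * p) = f a * f y * p.
    by rewrite -!mulrA [p * (_ * _)]mulrA pf -mulrA pp.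
  have gq a : g a * q * (g y * q) = g a * g y * q.
    by rewrite -!mulrA [q * (_ * _)]mulrA qg -mulrA qq.
  have fg a : f a * p * (g y * q) = 0.
    by rewrite -qg mulrA -[_ * p * q]mulrA pq mulr0 mul0r.
  have gf a : g a * q * (f y * p) = 0.
    by rewrite -pf mulrA -[_ * q * p]mulrA qp mulr0 mul0r.
  by rewrite (star_homM fH) (star_homM gH) mulrDl !mulrDr fp gq fg gf addr0 add0r.
- rewrite (star_hom_star fH) (star_hom_star gH) starD !starM sp sq.
  by rewrite -(star_hom_star fH) -(star_hom_star gH) pf qg.
Qed.

(** Two forms of one commutation relation between a unitary v and an involution w.
The left one is how a covariant pair moves w along the dynamics; the right one is
how w, generating an action of Z2, moves v. *)
Lemma symmetry_relation {A} {v w l : A} :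
  unitary v -> w * w = 1 -> l * l = 1 ->
  v * w * star v = v * l * star v * w <-> w * v * w = v * l.
Proof.
move=> [v1 v2] w2 l2; split=> [vw|wv].
  have wvE : w = l * star v * w * v.
    have := congr1 (fun a => star v * a * v) vw.
    by rewrite /= -!mulrA v1 mulr1 !mulrA v1 !mul1r.
  have -> : w * v = v * l * w.
    by rewrite {2}wvE !mulrA -[v * l * l]mulrA l2 mulr1 v2 mul1r.
  by rewrite -mulrA w2 mulr1.
have wvE : w * v = v * l * w by rewrite -wv -mulrA w2 mulr1.
rewrite -[RHS]mulr1 -v2 !mulrA -[_ * w * v]mulrA wvE !mulrA.
by rewrite -[_ * star v * v]mulrA v1 mulr1 -[v * l * l]mulrA l2 mulr1.
Qed.

End StarHomomorphisms.

(** * Covariant pairs *)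

Section Covariance.
Context {R : realType}.

Lemma covariant_pair_comp {A : starAlgType R} {G : zmodType} {beta : G -> A -> A}
    {B C : starAlgType R} {rho : A -> B} {U : G -> B} {f : B -> C} :
  covariant_pair beta rho U -> star_hom f ->
  covariant_pair beta (f \o rho) (f \o U).
Proof.
move=> [rhoH Uu UD UE] fH; split=> [|g|g h|g a] /=.
- exact: star_hom_comp.
- exact: star_hom_unitary.
- by rewrite UD star_homM.
- by rewrite -star_hom_star// -!star_homM// UE.
Qed.

(** The generators determine a homomorphism because f and g induce the same covariant
pair, which the universal property factors in only one way. *)
Lemma crossed_product_hom_eq {A : starAlgType R} {G : zmodType}
    {beta : G -> A -> A} {B C : cstarAlgType R} {rho : A -> B} {U : G -> B}
    {f g : B -> C} :
  is_crossed_product beta rho U -> star_hom f -> star_hom g ->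
  (forall a, f (rho a) = g (rho a)) -> (forall n, f (U n) = g (U n)) -> f = g.
Proof.
move=> [cB univ] fH gH fg_rho fg_U.
have [Phi [_ PhiU]] := univ C _ _ (covariant_pair_comp cB fH).
rewrite -(PhiU f); last by split.
by apply: PhiU; split=> //; apply/funext => ? /=; rewrite ?fg_rho ?fg_U.
Qed.

Lemma unitary_morph0 {G : zmodType} {B : starAlgType R} {U : G -> B} :
  {morph U : m n / m + n >-> m * n} -> (forall n, unitary (U n)) -> U 0 = 1.
Proof.
by move=> UD Uu; have [U1 _] := Uu 0; rewrite -[LHS]mul1r -{1}U1 -mulrA -UD addr0.
Qed.

Lemma unitary_morphN {G : zmodType} {B : starAlgType R} {U : G -> B} n :
  {morph U : m n / m + n >-> m * n} -> (forall n, unitary (U n)) ->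
  U (- n) = star (U n).
Proof.
move=> UD Uu; have [U1 _] := Uu n.
by rewrite -[LHS]mul1r -U1 -mulrA -UD subrr (unitary_morph0 UD Uu) mulr1.
Qed.

Lemma int_morph_eq {B : starAlgType R} {U V : int -> B} :
  {morph U : m n / m + n >-> m * n} -> (forall n, unitary (U n)) ->
  {morph V : m n / m + n >-> m * n} -> (forall n, unitary (V n)) ->
  U 1 = V 1 -> U =1 V.
Proof.
move=> UD Uu VD Vu UV1.
have UVnat (n : nat) : U n = V n.
  by elim: n => [|n IHn]; rewrite ?(unitary_morph0 UD Uu) ?(unitary_morph0 VD Vu)//
    intS UD VD UV1 IHn.
case=> n; first exact: UVnat.
by rewrite NegzE (unitary_morphN _ UD Uu) (unitary_morphN _ VD Vu) UVnat.
Qed.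

Lemma homeo_action_covariant1 {Z : ptopologicalType} {gamma : homeo Z Z}
    {B : starAlgType R} {rho : cfun R Z -> B} {U : int -> B} f :
  covariant_pair (homeo_action gamma) rho U ->
  U 1 * rho f * star (U 1) = rho (cfun_comp f (homeo_sym gamma)).
Proof. by case=> _ _ _ UE; exact: (UE 1). Qed.

(** Covariance at the generator 1 propagates to all integers. For negative ones,
f o gamma o gamma^-1 = f turns the relation at 1 into the relation at -1. *)
Lemma homeo_action_covariant {Z : ptopologicalType} {gamma : homeo Z Z}
    {B : starAlgType R} {rho : cfun R Z -> B} {U : int -> B} :
  star_hom rho -> {morph U : m n / m + n >-> m * n} ->
  (forall n, unitary (U n)) ->
  (forall f, U 1 * rho f * star (U 1) = rho (cfun_comp f (homeo_sym gamma))) ->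
  covariant_pair (homeo_action gamma) rho U.
Proof.
move=> rhoH UD Uu U1E; split=> // n f.
have U1NE h : U (- 1) * rho h * star (U (- 1)) = rho (cfun_comp h gamma).
  have [uu _] := Uu 1; rewrite (unitary_morphN _ UD Uu) starK.
  have {1}-> : h = cfun_comp (cfun_comp h gamma) (homeo_sym gamma).
    by apply: cfunP => z; rewrite -[RHS]/(h (gamma (homeo_inv gamma z))) homeo_invK.
  by rewrite -U1E !mulrA uu mul1r -mulrA uu mulr1.
case: n => n; rewrite ?NegzE.
  elim: n => [|n IHn]; first by rewrite (unitary_morph0 UD Uu) star1 mul1r mulr1.
  by rewrite intS UD starM -U1E -IHn !mulrA.
elim: n => [|n IHn]; first exact: U1NE.
rewrite intS opprD UD starM.
have -> : homeo_action gamma (Negz n.+1) f =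
    cfun_comp (homeo_action gamma (Negz n) f) gamma by [].
by rewrite -U1NE -IHn !mulrA.
Qed.

Lemma Z2_cases (k : Z2) : k = (0 : 'Z_2) \/ k = (1 : 'Z_2).
Proof. by case: k => -[|[|//]] i; [left|right]; apply: val_inj. Qed.

Lemma Z2_action_covariant {A B : starAlgType R} {theta : A -> A}
    {rho : A -> B} {w : B} :
  star_hom rho -> star w = w -> w * w = 1 ->
  (forall a, w * rho a * w = rho (theta a)) ->
  covariant_pair (Z2_action theta) rho (fun k : Z2 => w ^+ nat_of_ord k).
Proof.
move=> rhoH sw w2 wE; split=> // [k|k l|k a].
- by case: (Z2_cases k) => ->; split; rewrite ?expr0 ?expr1 ?star1 ?mulr1 ?sw.
- case: (Z2_cases k) (Z2_cases l) => -> [] ->;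
  by rewrite ?expr0 ?expr1 ?mul1r ?mulr1 ?w2.
- by case: (Z2_cases k) => ->; rewrite ?expr0 ?expr1 ?star1 ?mul1r ?mulr1 ?sw ?wE.
Qed.

End Covariance.

(** * Functions on the double cover X * Z2 * T of X * T *)

Section DoubleCover.
Context {R : realType} {X : ptopologicalType}.
Local Notation T := (circle R).
Local Notation XT := (X * T)%type.
Local Notation XZT := (X * Z2 * T)%type.

Definition cfun_pullback {Y Z : ptopologicalType} (h : continuousType Y Z)
    (f : cfun R Z) : cfun R Y :=
  mkcts (fun y => continuous_comp (@cts_fun _ _ h y) (@cts_fun _ _ f (h y))).

Lemma cfun_pullback_star_hom {Y Z : ptopologicalType}
  (h : continuousType Y Z) : star_hom (cfun_pullback h).
Proof.
by split=> [a f g||f]; [|split=> [|f g]|]; apply: cfunP.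
Qed.

Lemma cover_proj_cts : continuous (fun p : XZT => (p.1.1, p.2)).
Proof.
apply: pair_cts => p; last exact: cvg_snd.
by apply: (@continuous_comp _ _ _ fst fst); exact: cvg_fst.
Qed.

Lemma sheet_cts (k : Z2) : continuous (fun p : XT => (p.1, k, p.2)).
Proof.
apply: pair_cts => [|p]; last exact: cvg_snd.
by apply: pair_cts => p; [exact: cvg_fst|exact: cvg_cst].
Qed.

Lemma sheet_sign_cts :
  continuous (fun p : XZT => (-1) ^+ nat_of_ord p.1.2 : R[i]^o).
Proof.
move=> p O Op; have : nbhs p ((fun q : XZT => q.1.2) @^-1` [set p.1.2]).
  apply: (@continuous_comp _ _ _ fst snd p); [exact: cvg_fst|exact: cvg_snd|].
  exact: discrete_set1.
by apply: filterS => q /= ->; exact: nbhs_singleton.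
Qed.

Definition cover_lift : cfun R XT -> cfun R XZT := cfun_pullback (mkcts cover_proj_cts).
Definition sheet (k : Z2) : cfun R XZT -> cfun R XT :=
  cfun_pullback (mkcts (sheet_cts k)).
Definition sheet_sign : cfun R XZT := mkcts sheet_sign_cts.

Lemma sheet_star_hom k : star_hom (sheet k).
Proof. exact: cfun_pullback_star_hom. Qed.

Lemma cover_lift_star_hom : star_hom cover_lift.
Proof. exact: cfun_pullback_star_hom. Qed.

Lemma sheet_lift k f : sheet k (cover_lift f) = f.
Proof. by apply: cfunP => -[]. Qed.

Lemma sheet0_sign : sheet (0 : 'Z_2) sheet_sign = 1.
Proof. exact: cfunP. Qed.

Lemma sheet1_sign : sheet (1 : 'Z_2) sheet_sign = - 1.
Proof. exact: cfunP. Qed.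

Lemma sheet_inj f g : (forall k, sheet k f = sheet k g) -> f = g.
Proof.
move=> fg; apply: cfunP => -[[x k] t].
exact: (congr1 (fun h : cfun R XT => h (x, t)) (fg k)).
Qed.

Lemma star_sheet_sign : star sheet_sign = sheet_sign.
Proof.
apply: sheet_inj => k; rewrite (star_hom_star (sheet_star_hom k)).
case: (Z2_cases k) => ->; rewrite ?sheet0_sign ?sheet1_sign ?star1//.
by rewrite -scaleN1r starZ star1 rmorphN1.
Qed.

Lemma sqr_sheet_sign : sheet_sign * sheet_sign = 1.
Proof.
apply: sheet_inj => k.
rewrite (star_homM (sheet_star_hom k)) (star_hom1 (sheet_star_hom k)).
by case: (Z2_cases k) => ->; rewrite ?sheet0_sign ?sheet1_sign ?mulrNN mulr1.
Qed.

Lemma addr_halves (V : lmodType R[i]) (a b : V) :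
  2^-1 *: (a + b) + 2^-1 *: (a - b) = a.
Proof.
by rewrite -scalerDr addrACA subrr addr0 -(mulr2n a) -(scaler_nat 2 a)
  scalerA mulVf ?scale1r// pnatr_eq0.
Qed.

(** The even and odd parts of f under the exchange of the two sheets. *)
Lemma sheet_decomposition f :
  f = cover_lift (2^-1 *: (sheet (0 : 'Z_2) f + sheet (1 : 'Z_2) f)) +
      cover_lift (2^-1 *: (sheet (0 : 'Z_2) f - sheet (1 : 'Z_2) f)) * sheet_sign.
Proof.
apply: sheet_inj => k; have sk := sheet_star_hom k.
rewrite (star_homD sk) (star_homM sk) !sheet_lift.
case: (Z2_cases k) => ->; rewrite ?sheet0_sign ?sheet1_sign.
  by rewrite mulr1 addr_halves.
by rewrite mulrN1 -scalerN opprB addrC (addrC (sheet (0 : 'Z_2) f)) addrC addr_halves.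
Qed.

Lemma sheet_hom_eq {B : starAlgType R} {F G : cfun R XZT -> B} :
  star_hom F -> star_hom G ->
  (forall f, F (cover_lift f) = G (cover_lift f)) -> F sheet_sign = G sheet_sign ->
  forall f, F f = G f.
Proof.
move=> FH GH FGl FGs f; rewrite (sheet_decomposition f).
have homE (K : cfun R XZT -> B) a b : star_hom K ->
    K (cover_lift a + cover_lift b * sheet_sign) =
    K (cover_lift a) + K (cover_lift b) * K sheet_sign.
  by move=> KH; rewrite (star_homD KH) (star_homM KH).
rewrite (homE F)// (homE G)//; congr (_ + _ * _) => //; exact: FGl.
Qed.

(** The projections (1 + w) / 2 and (1 - w) / 2 play the part of the indicator
functions of the two sheets; J f is assembled from the restrictions of f to the
sheets, each cut down by its projection. *)
Lemma sheet_hom_ex {B : starAlgType R} {j : cfun R XT -> B} {w : B} :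
  star_hom j -> star w = w -> w * w = 1 -> (forall f, w * j f = j f * w) ->
  exists J : cfun R XZT -> B,
    [/\ star_hom J, forall f, J (cover_lift f) = j f & J sheet_sign = w].
Proof.
move=> jH sw w2 wj.
pose p : B := 2^-1 *: (1 + w); pose q : B := 2^-1 *: (1 - w).
have pq1 : p + q = 1 by exact: addr_halves.
have pBq : p - q = w.
  by rewrite /p /q -scalerN opprB (addrC 1) addr_halves.
have pq : p * q = 0.
  rewrite /p /q -scalerAl -scalerAr mulrDl mul1r mulrBr mulr1 w2.
  by rewrite addrC subrKA subrr !scaler0.
have half_conj : (2^-1 : R[i])^*%C = 2^-1 by rewrite conjc_inv conjc_nat.
have sp : star p = p by rewrite /p starZ half_conj starD star1 sw.
have sq : star q = q.
  by rewrite -[q](addKr p) pq1 starD star1 -scaleN1r starZ rmorphN1 sp.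
have pj f : p * j f = j f * p.
  by rewrite /p -scalerAl -scalerAr mulrDl mulrDr wj mul1r mulr1.
have qj f : q * j f = j f * q.
  by rewrite /q -scalerAl -scalerAr mulrBl mulrBr wj mul1r mulr1.
exists (fun f => (j \o sheet (0 : 'Z_2)) f * p + (j \o sheet (1 : 'Z_2)) f * q).
split=> [|f|] /=.
- have jsH k := star_hom_comp (sheet_star_hom k) jH.
  by apply: (star_hom_orthogonal_sum (jsH _) (jsH _)) => // f; [exact: pj|exact: qj].
- by rewrite !sheet_lift -mulrDr pq1 mulr1.
- rewrite sheet0_sign sheet1_sign (star_homN jH) (star_hom1 jH).
  by rewrite mul1r mulN1r.
Qed.

End DoubleCover.

(** * The dynamics on the double cover *)

Section OrientationCover.
Context {R : realType} {X : ptopologicalType} (alpha : homeo X X).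
Local Notation T := (circle R).
Variable phi : continuousType X (homeo T T).
Local Notation delta := (skew_product alpha phi).
Local Notation gamma := (orientation_extension alpha phi).
Local Notation g := (orientation_sign phi).

Lemma cfun_comp_star_hom {Z : ptopologicalType} (h : homeo Z Z) :
  star_hom ((@cfun_comp R Z)^~ h).
Proof.
by split=> [a f f'||f]; [|split=> [|f f']|]; apply: cfunP.
Qed.

Lemma cover_lift_comp f :
  cfun_comp (cover_lift f) (homeo_sym gamma) =
  cover_lift (cfun_comp f (homeo_sym delta)).
Proof. by apply: cfunP => -[[x k] t]. Qed.

Lemma Z2_signB (S : pzRingType) (k l : Z2) :
  (-1) ^+ nat_of_ord (k - l) = (-1) ^+ nat_of_ord l * (-1) ^+ nat_of_ord k :> S.
Proof.
by case: (Z2_cases k) (Z2_cases l) => -> [] ->;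
  rewrite ?expr0 ?expr1 ?mulrNN ?mulr1 ?mul1r.
Qed.

(** The inverse of gamma sends (x,k,t) to the sheet k - o(y), where y is the preimage
of x under alpha; the sign of o(y) is g o delta^-1 at (x,t). *)
Lemma sheet_sign_comp :
  cfun_comp (@sheet_sign R X) (homeo_sym gamma) =
  cover_lift (cfun_comp g (homeo_sym delta)) * sheet_sign.
Proof. by apply: cfunP => -[[x k] t]; exact: Z2_signB. Qed.

Lemma sqr_orientation_sign : g * g = 1.
Proof.
apply: cfunP => -[x t].
rewrite -[LHS]/((-1) ^+ nat_of_ord (orientation_cocycle phi x) *
                (-1) ^+ nat_of_ord (orientation_cocycle phi x) : R[i]).
by rewrite -expr2 sqrr_sign.
Qed.

Lemma cover_covariant_lift {B : starAlgType R} {J : cfun R (X * Z2 * T)%type -> B}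
    {V : int -> B} :
  covariant_pair (homeo_action gamma) J V ->
  covariant_pair (homeo_action delta) (J \o cover_lift) V.
Proof.
move=> cJ; case: (cJ) => JH Vu VD _.
apply: homeo_action_covariant => // [|f].
  exact: star_hom_comp cover_lift_star_hom JH.
exact: etrans (homeo_action_covariant1 _ cJ) (congr1 J (cover_lift_comp f)).
Qed.

(** The covariance relation of V at the function [sheet_sign], rearranged by
[symmetry_relation]. *)
Lemma cover_covariant_sign {B : starAlgType R} {J : cfun R (X * Z2 * T)%type -> B}
    {V : int -> B} :
  covariant_pair (homeo_action gamma) J V ->
  J sheet_sign * V 1 * J sheet_sign = V 1 * J (cover_lift g).
Proof.
move=> cJ; case: (cJ) => JH Vu _ _.
have liftH : star_hom (J \o cover_lift) := star_hom_comp cover_lift_star_hom JH.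
apply/(symmetry_relation (Vu 1)).
- by rewrite -(star_homM JH) sqr_sheet_sign (star_hom1 JH).
- by rewrite -(star_homM liftH) sqr_orientation_sign (star_hom1 liftH).
- rewrite !(homeo_action_covariant1 _ cJ) cover_lift_comp sheet_sign_comp.
  by rewrite (star_homM JH).
Qed.

(** [sheet_hom_ex] gives J. Covariance compares two homomorphisms on
C(X * Z2 * T), so it need only be tested on functions from X * T, where it is
that of j, and on [sheet_sign], where it is the relation between w and U 1. *)
Lemma cover_covariant_ex {B : starAlgType R} {j : cfun R (X * T)%type -> B}
    {U : int -> B} {w : B} :
  covariant_pair (homeo_action delta) j U ->
  star w = w -> w * w = 1 -> (forall f, w * j f = j f * w) ->
  w * U 1 * w = U 1 * j g ->
  exists J, [/\ covariant_pair (homeo_action gamma) J U,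
    forall f, J (cover_lift f) = j f & J sheet_sign = w].
Proof.
move=> cj sw w2 wj wU; case: (cj) => jH Uu UD _.
have [J [JH Jlift Jsign]] := sheet_hom_ex jH sw w2 wj.
exists J; split=> //; apply: homeo_action_covariant => //.
apply: (sheet_hom_eq (star_hom_comp JH (star_hom_conj (Uu 1)))
  (star_hom_comp (cfun_comp_star_hom _) JH)) => [f|] /=.
  by rewrite cover_lift_comp !Jlift; exact: homeo_action_covariant1.
rewrite sheet_sign_comp (star_homM JH) Jlift Jsign -(homeo_action_covariant1 _ cj).
apply/(symmetry_relation (Uu 1) w2) => //.
by rewrite -(star_homM jH) sqr_orientation_sign (star_hom1 jH).
Qed.

End OrientationCover.

(** * The isomorphism of the crossed products *)

Theorem proposition8p2 (R : realType) (X : ptopologicalType)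
  (hX : is_cantor_set X) (alpha : homeo X X) (halpha : minimal_homeo alpha)
  (phi : continuousType X (homeo (circle R) (circle R)))
  (hphi : ~ skew_orientation_preserving alpha phi)
  (A : cstarAlgType R) (iota : cfun R (X * circle R)%type -> A) (U : int -> A)
  (hA : is_transformation_algebra (skew_product alpha phi) iota U)
  (theta : A -> A) (theta_aut : star_iso theta) (theta2 : order_two theta)
  (theta_iota : forall f, theta (iota f) = iota f)
  (theta_u : theta (U 1) = U 1 * iota (orientation_sign phi))
  (B : cstarAlgType R) (rho : A -> B) (W : Z2 -> B)
  (hB : is_crossed_product (Z2_action theta) rho W)
  (D : cstarAlgType R) (iotaD : cfun R (X * Z2 * circle R)%type -> D)
  (V : int -> D)
  (hD : is_transformation_algebra (orientation_extension alpha phi) iotaD V) :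
  star_isomorphic D B.
Proof.
have cA := crossed_product_covariant hA.
have cB := crossed_product_covariant hB.
have cD := crossed_product_covariant hD.
have [iotaH _ _ _] := cA; have [rhoH Wu WD WE] := cB; have [iotaDH _ _ _] := cD.
have [thetaH _] := theta_aut.
have ri_cov := covariant_pair_comp cA rhoH.
pose w := W (1 : 'Z_2); pose s := iotaD sheet_sign.
have w2 : w * w = 1.
  by rewrite -WD -(unitary_morph0 WD Wu); congr (W _); exact: val_inj.
have sw : star w = w.
  by rewrite -[LHS](unitary_morphN _ WD Wu); congr (W _); exact: val_inj.
have wE a : w * rho a * w = rho (theta a) by rewrite -{2}sw WE.
have w_iota f : w * rho (iota f) = rho (iota f) * w.
  by rewrite -{2}(theta_iota f) -wE -mulrA w2 mulr1.
have wU : w * rho (U 1) * w = rho (U 1) * rho (iota (orientation_sign phi)).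
  by rewrite wE theta_u (star_homM rhoH).
have [J [cJ Jlift Jsign]] := cover_covariant_ex _ _ ri_cov sw w2 w_iota wU.
have [Phi [[PhiH PhiD PhiV] _]] := crossed_product_universal hD cJ.
have cL := cover_covariant_lift _ _ cD.
have [Psi0 [[Psi0H Psi0i Psi0U] _]] := crossed_product_universal hA cL.
have Psi0iE f : Psi0 (iota f) = iotaD (cover_lift f) := congr1 (@^~ f) Psi0i.
have Psi0UE n : Psi0 (U n) = V n := congr1 (@^~ n) Psi0U.
have ss : star s = s by rewrite -(star_hom_star iotaDH) star_sheet_sign.
have s2 : s * s = 1.
  by rewrite -(star_homM iotaDH) sqr_sheet_sign (star_hom1 iotaDH).
have s_lift f : s * iotaD (cover_lift f) = iotaD (cover_lift f) * s.
  by rewrite -!(star_homM iotaDH) mulrC.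
(* Both sides are homomorphisms on A; covariance of Psi0 and s only has to be
   tested on C(X * T) and on the implementing unitary. *)
have s_theta : (fun b => s * b * s) \o Psi0 = Psi0 \o theta.
  have conjH : star_hom (fun b => s * b * s).
    by rewrite -{2}ss; apply: star_hom_conj; rewrite /unitary ss s2.
  have c1 := covariant_pair_comp cA (star_hom_comp Psi0H conjH).
  have c2 := covariant_pair_comp cA (star_hom_comp thetaH Psi0H).
  apply: (crossed_product_hom_eq hA (star_hom_comp Psi0H conjH)
    (star_hom_comp thetaH Psi0H)) => [f|].
    by rewrite /= theta_iota Psi0iE s_lift -mulrA s2 mulr1.
  apply: int_morph_eq (covariantD c1) (covariant_unitary c1)
    (covariantD c2) (covariant_unitary c2) _.
  rewrite /= theta_u (star_homM Psi0H) Psi0UE Psi0iE.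
  exact: cover_covariant_sign cD.
have cPsi : covariant_pair (Z2_action theta) Psi0
    (fun k : Z2 => s ^+ nat_of_ord k).
  by apply: Z2_action_covariant => // a; exact: (congr1 (@^~ a) s_theta).
have [Psi [[PsiH PsiR PsiW] _]] := crossed_product_universal hB cPsi.
have PhiDE f : Phi (iotaD f) = J f := congr1 (@^~ f) PhiD.
have PhiVE n : Phi (V n) = rho (U n) := congr1 (@^~ n) PhiV.
have PsiRE a : Psi (rho a) = Psi0 a := congr1 (@^~ a) PsiR.
have PsiWE k : Psi (W k) = s ^+ nat_of_ord k := congr1 (@^~ k) PsiW.
have PhiPsi0 : Phi \o Psi0 = rho.
  apply: (crossed_product_hom_eq hA (star_hom_comp Psi0H PhiH) rhoH) => [f|n] /=.
    by rewrite Psi0iE PhiDE Jlift.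
  by rewrite Psi0UE PhiVE.
have PhiPsi : Phi \o Psi = id.
  apply: (crossed_product_hom_eq hB (star_hom_comp PsiH PhiH) star_hom_id)
    => [a|k] /=.
    by rewrite PsiRE; exact: (congr1 (@^~ a) PhiPsi0).
  rewrite PsiWE (star_homX _ PhiH) PhiDE Jsign.
  by case: (Z2_cases k) => ->; rewrite ?expr0 ?expr1 ?(unitary_morph0 WD Wu).
have PsiPhi : Psi \o Phi = id.
  apply: (crossed_product_hom_eq hD (star_hom_comp PhiH PsiH) star_hom_id)
    => [f|n] /=; last by rewrite PhiVE PsiRE Psi0UE.
  rewrite PhiDE; move: f.
  apply: (sheet_hom_eq (star_hom_comp (covariant_hom cJ) PsiH) iotaDH) => [f|] /=.
    by rewrite Jlift PsiRE Psi0iE.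
  by rewrite Jsign PsiWE expr1.
exists Phi; split=> //; exists Psi => x.
  exact: (congr1 (@^~ x) PsiPhi).
exact: (congr1 (@^~ x) PhiPsi).
Qed.
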